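(* Let $\mathbf p\in\mathbb R^T$ be a given market price and, for every $i\in I$, let $N_i(\mathbf p,\mathbf x_i)$ be a real-valued function of $\mathbf x_i\in X_i$ with $N_i(\mathbf p,\mathbf x_i)\ge0$ for all $\mathbf x_i\in X_i$. Then: 1. \[ \max_{v\ge0}\ \min_{\mathbf x_i\in X_i,\,\forall i\in I}L(\mathbf p,v,\mathbf x)=\min_{\mathbf x_i\in X_i,\,\forall i\in I}L(\mathbf p,0,\mathbf x), \] and consequently $\min_{v\ge0}\sum_{i\in I}\pi_i^+(\mathbf p,v)=\sum_{i\in I}\pi_i^{st.+}(\mathbf p)$. 2. If $v^+\ge0$ is an optimal solution of the maximization over $v\ge0$ on the left-hand side in item 1, then $\pi_i^+(\mathbf p,v^+)=\pi_i^{st.+}(\mathbf p)$ for all $i\in I$. Moreover, the set $\{v\ge0:\pi_i^+(\mathbf p,v)=\pi_i^{st.+}(\mathbf p)\ \forall i\in I\}$ equals the set of maximizers of that problem. 3. Dualizing the constraint $\sum_{i\in I}N_i(\mathbf p,\mathbf x_i)\ge0$ together with the power balance constraint does not change the duality gap resulting from dualizing the power balance constraint alone: \[ f^*-\max_{\mathbf q\in\mathbb R^T,\,v\ge0}\ \min_{\mathbf x_i\in X_i,\,\forall i\in I}L(\mathbf q,v,\mathbf x)=f^*-\max_{\mathbf q\in\mathbb R^T}\ \min_{\mathbf x_i\in X_i,\,\forall i\in I}L(\mathbf q,0,\mathbf x). \] 4. If $\sum_{i\in I}N_i(\mathbf p,\mathbf x_i^* )>0$, then the set of maximizers in item 2 has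 the form $[0,v_{\max}^+(\mathbf p)]$ for some real $v_{\max}^+(\mathbf p)\ge0$, and \[ \min_{\substack{v\ge 0\\ \text{s.t. } \pi_i^+(\mathbf p,v)=\pi_i^{st.+}(\mathbf p)\ \forall i\in I}}\ \sum_{i\in I}\bigl[\pi_i^+(\mathbf p,v)-\pi_i^*(\mathbf p,v)\bigr]=f^*-\min_{\mathbf x_i\in X_i,\,\forall i\in I}L(\mathbf p,0,\mathbf x)-v_{\max}^+(\mathbf p)\sum_{i\in I}N_i(\mathbf p,\mathbf x_i^* ). \]
   Context: Setting: a $T$-period uninode power market with fixed load $\mathbf d\in\mathbb R_{\ge0}^T$ and a finite set $I$ of producers. For producer $i\in I$ and period $t\in\{1,\dots,T\}$, $u_i^t$ and $g_i^t$ are the (real) commitment and output variables; $\mathbf g_i=(g_i^1,\dots,g_i^T)$, $\mathbf u_i=(u_i^1,\dots,u_i^T)$, $x_i^t=(u_i^t,g_i^t)$, $\mathbf x_i=(x_i^1,\dots,x_i^T)$, $\mathbf x=(\mathbf x_i)_{i\in I}$. The private feasible set $X_i$ of producer $i$ (a set of possible $\mathbf x_i$) is nonempty and compact, and $C_i:X_i\to\mathbb R$ is its cost function. The centralized dispatch problem is \[ f^*=\min\Bigl\{\sum_{i\in I}C_i(\mathbf x_i)\ :\ \mathbf x_i\in X_i\ \forall i\in I,\ \sum_{i\in I}\mathbf g_i=\mathbf d\Bigr\}. \] Its feasible set is assumed nonempty; $\mathbf x^*=(\mathbf x_i^* )_{i\in I}$ denotes a fixed optimal point of this problem. The constraint $\sum_{i\in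 I}\mathbf g_i=\mathbf d$ is the power balance constraint. For $\mathbf p\in\mathbb R^T$ define the producer profit $\pi_i^{st.}(\mathbf p,\mathbf x_i)=\mathbf p^T\mathbf g_i-C_i(\mathbf x_i)$ and its maximum $\pi_i^{st.+}(\mathbf p)=\max_{\mathbf x_i\in X_i}\pi_i^{st.}(\mathbf p,\mathbf x_i)$. Given functions $N_i(\mathbf p,\cdot)$ on $X_i$ (with $\mathbf p$ treated as a fixed parameter), define for $\mathbf q\in\mathbb R^T$ and $v\ge0$ the Lagrange function \[ L(\mathbf q,v,\mathbf x)=\mathbf q^T\Bigl(\mathbf d-\sum_{i\in I}\mathbf g_i\Bigr)-v\sum_{i\in I}N_i(\mathbf p,\mathbf x_i)+\sum_{i\in I}C_i(\mathbf x_i), \] and \[ \pi_i(\mathbf p,v,\mathbf x_i)=\pi_i^{st.}(\mathbf p,\mathbf x_i)+vN_i(\mathbf p,\mathbf x_i),\quad \pi_i^*(\mathbf p,v)=\pi_i(\mathbf p,v,\mathbf x_i^* ),\quad \pi_i^+(\mathbf p,v)=\max_{\mathbf x_i\in X_i}\pi_i(\mathbf p,v,\mathbf x_i). \] Maxima and minima over $\mathbf x_i\in X_i$, and the maximum over $\mathbf q\in\mathbb R^T$ of $\min_{\mathbf x}L(\mathbf q,0,\mathbf x)$, are assumed to be attained. *)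

(* Defs.v *)
From HB Require Import structures.
From mathcomp Require Import all_boot all_order all_algebra.
From mathcomp Require Import all_classical all_reals all_analysis.

Set Implicit Arguments.
Unset Strict Implicit.
Unset Printing Implicit Defensive.

Import Order.TTheory GRing.Theory Num.Theory.
Import numFieldNormedType.Exports.

Local Open Scope classical_set_scope.
Local Open Scope ring_scope.

(* [max_on A f] and [min_on A f] are the maximum and the minimum of [f] on [A]
   only if these are attained, that is, if [argmax A f] (resp. [argmin A f]) is
   nonempty; attainment is always stated separately. *)

Definition argmax (R : realType) (S : Type) (A : set S) (f : S -> R) : set S :=
  [set a | A a /\ forall b, A b -> f b <= f a].

Definition argmin (R : realType) (S : Type) (A : set S) (f : S -> R) : set S :=
  [set a | A a /\ forall b, A b -> f a <= f b].

Definition max_on (R : realType) (S : Type) (A : set S) (f : S -> R) : R :=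
  sup [set f a | a in A].

Definition min_on (R : realType) (S : Type) (A : set S) (f : S -> R) : R :=
  inf [set f a | a in A].

(* The plan of one producer: the entry in period t is the pair
   (commitment, output). *)
Notation plan R T := ('rV[(R * R)%type]_T).

Definition output (R : realType) (T : nat) (x : plan R T) : 'rV[R]_T :=
  \row_t (x 0 t).2.

Definition dotp (R : realType) (T : nat) (p g : 'rV[R]_T) : R :=
  \sum_t p 0 t * g 0 t.

Definition profiles (R : realType) (T : nat) (I : finType)
    (X : I -> set (plan R T)) : set (I -> plan R T) :=
  [set x | forall i, X i (x i)].

(* Costs [C i] and functions [N i p] are total on plans; only their values on
   [X i] are ever used. *)

Definition total_cost (R : realType) (T : nat) (I : finType)
    (C : I -> plan R T -> R) (x : I -> plan R T) : R :=
  \sum_i C i (x i).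

Definition feasible (R : realType) (T : nat) (I : finType) (d : 'rV[R]_T)
    (X : I -> set (plan R T)) : set (I -> plan R T) :=
  [set x | profiles X x /\ \sum_i output (x i) = d].

Definition fstar (R : realType) (T : nat) (I : finType) (d : 'rV[R]_T)
    (X : I -> set (plan R T)) (C : I -> plan R T -> R) : R :=
  min_on (feasible d X) (total_cost C).

Definition profit_st (R : realType) (T : nat) (I : finType)
    (C : I -> plan R T -> R) (i : I) (p : 'rV[R]_T) (x : plan R T) : R :=
  dotp p (output x) - C i x.

Definition profit_st_max (R : realType) (T : nat) (I : finType)
    (X : I -> set (plan R T)) (C : I -> plan R T -> R)
    (i : I) (p : 'rV[R]_T) : R :=
  max_on (X i) (profit_st C i p).

Definition profit (R : realType) (T : nat) (I : finType)
    (C : I -> plan R T -> R) (N : I -> 'rV[R]_T -> plan R T -> R)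
    (i : I) (p : 'rV[R]_T) (v : R) (x : plan R T) : R :=
  profit_st C i p x + v * N i p x.

Definition profit_max (R : realType) (T : nat) (I : finType)
    (X : I -> set (plan R T)) (C : I -> plan R T -> R)
    (N : I -> 'rV[R]_T -> plan R T -> R) (i : I) (p : 'rV[R]_T) (v : R) : R :=
  max_on (X i) (profit C N i p v).

(* [p] is the fixed market price inside [N]; [q] is the dual variable of the
   power balance constraint. *)
Definition lagrangian (R : realType) (T : nat) (I : finType) (d : 'rV[R]_T)
    (C : I -> plan R T -> R) (N : I -> 'rV[R]_T -> plan R T -> R)
    (p q : 'rV[R]_T) (v : R) (x : I -> plan R T) : R :=
  dotp q (d - \sum_i output (x i)) - v * (\sum_i N i p (x i))
  + \sum_i C i (x i).

Definition min_lagrangian (R : realType) (T : nat) (I : finType) (d : 'rV[R]_T)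
    (X : I -> set (plan R T)) (C : I -> plan R T -> R)
    (N : I -> 'rV[R]_T -> plan R T -> R) (p q : 'rV[R]_T) (v : R) : R :=
  min_on (profiles X) (lagrangian d C N p q v).

Definition nonneg (R : realType) : set R := [set v | 0 <= v].
Arguments nonneg : clear implicits.

Definition profit_preserving (R : realType) (T : nat) (I : finType)
    (X : I -> set (plan R T)) (C : I -> plan R T -> R)
    (N : I -> 'rV[R]_T -> plan R T -> R) (p : 'rV[R]_T) : set R :=
  [set v | 0 <= v /\
           forall i, profit_max X C N i p v = profit_st_max X C i p].

(* Main.v *)
Require Import Defs.
From HB Require Import structures.
From mathcomp Require Import all_boot all_order all_algebra.
From mathcomp Require Import all_classical all_reals all_analysis.
From mathcomp Require Import ring.

Set Implicit Arguments.
Unset Strict Implicit.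
Unset Printing Implicit Defensive.

Import Order.TTheory GRing.Theory Num.Theory.
Import numFieldNormedType.Exports.

Local Open Scope classical_set_scope.
Local Open Scope ring_scope.

(** At q = p the Lagrangian separates, L(p, v, x) = p.d - sum_i pi_i(p, v, x_i),
    so its minimum is p.d - sum_i pi_i^+(p, v). As N_i >= 0, each pi_i^+ is at
    least pi_i^{st.+}, with equality at v = 0; a sum of termwise inequalities is
    tight only if every term is, which gives items 1 and 2. Item 3 holds since
    L(q, v, x) <= L(q, 0, x). With m0 the minimum of L(p, 0, .), the maximizers v
    of item 2 are cut out of v >= 0 by the linear inequalities
    v * sum_i N_i(x_i) <= L(p, 0, x) - m0, so they form an interval [0, vmax],
    bounded because of x = xstar; on it the objective of item 4 is
    fstar - m0 - v * sum_i N_i(xstar_i), which is least at vmax. *)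

Lemma argmax_max_on (R : realType) (S : Type) (A : set S) (f : S -> R) (a : S) :
  argmax A f a -> max_on A f = f a.
Proof.
move=> [Aa fa]; apply/eqP; rewrite eq_le; apply/andP; split.
  by apply: ge_sup; [exists (f a), a | move=> _ [b Ab <-]; exact: fa].
by apply: ub_le_sup; [exists (f a) => _ [b Ab <-]; exact: fa | exists a].
Qed.

Lemma argmin_min_on (R : realType) (S : Type) (A : set S) (f : S -> R) (a : S) :
  argmin A f a -> min_on A f = f a.
Proof.
move=> [Aa fa]; apply/eqP; rewrite eq_le; apply/andP; split.
  by apply: ge_inf; [exists (f a) => _ [b Ab <-]; exact: fa | exists a].
by apply: lb_le_inf; [exists (f a), a | move=> _ [b Ab <-]; exact: fa].
Qed.

Lemma le_max_on (R : realType) (S : Type) (A : set S) (f : S -> R) (a : S) :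
  argmax A f !=set0 -> A a -> f a <= max_on A f.
Proof. by move=> [b bmax] Aa; rewrite (argmax_max_on bmax); exact: bmax.2. Qed.

Lemma min_on_le (R : realType) (S : Type) (A : set S) (f : S -> R) (a : S) :
  argmin A f !=set0 -> A a -> min_on A f <= f a.
Proof. by move=> [b bmin] Aa; rewrite (argmin_min_on bmin); exact: bmin.2. Qed.

(** Turns optimality into one equation between values; the known maximizer [a] will be [v = 0]. *)
Lemma eq_argmax (R : realType) (S : Type) (A : set S) (f : S -> R) (a b : S) :
  argmax A f a -> A b -> argmax A f b <-> f b = f a.
Proof.
move=> [Aa fa] Ab; split=> [[_ fb]|fba]; last by split=> // c /fa; rewrite fba.
by apply/eqP; rewrite eq_le fa ?fb.
Qed.

(** The differences [g i - f i] are nonnegative and sum to zero, so each of them vanishes. *)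
Lemma eq_sum_le (R : realType) (I : finType) (f g : I -> R) :
  (forall i, f i <= g i) -> \sum_i g i = \sum_i f i -> forall i, g i = f i.
Proof.
move=> le_fg eq_gf i; apply/eqP; rewrite -subr_eq0; apply/eqP.
have sum0 : \sum_j (g j - f j) = 0 by rewrite sumrB eq_gf subrr.
by apply: (psumr_eq0P _ sum0) => // j _; rewrite subr_ge0.
Qed.

Lemma dotpBr (R : realType) (T : nat) (p g h : 'rV[R]_T) :
  dotp p (g - h) = dotp p g - dotp p h.
Proof. by rewrite /dotp -sumrB; apply: eq_bigr => t _; rewrite !mxE mulrBr. Qed.

Lemma dotp_sumr (R : realType) (T : nat) (I : finType) (p : 'rV[R]_T)
    (g : I -> 'rV[R]_T) :
  dotp p (\sum_i g i) = \sum_i dotp p (g i).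
Proof.
rewrite /dotp exchange_big; apply: eq_bigr => t _.
by rewrite summxE mulr_sumr.
Qed.

(** The constraint at [y] bounds [v] by [a y / b y], so [vmax] can be the supremum. As [b] is
    nonnegative, each constraint passes from [vmax] to all smaller [v]. *)
Lemma linear_constraints_itv (R : realType) (S : Type) (A : set S)
    (a b : S -> R) (y : S) :
  (forall x, A x -> 0 <= a x) -> (forall x, A x -> 0 <= b x) ->
  A y -> 0 < b y ->
  exists2 vmax, 0 <= vmax &
    [set v : R | 0 <= v /\ forall x, A x -> v * b x <= a x]
      = `[0, vmax]%classic.
Proof.
move=> a_ge0 b_ge0 Ay by_gt0.
set V := [set v : R | _].
have V0 : V 0 by split=> // x Ax; rewrite mul0r a_ge0.
have V_ub : has_ubound V.
  by exists (a y / b y) => v [_ /(_ y Ay)]; rewrite ler_pdivlMr.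
have vmax_ge0 : 0 <= sup V by exact: ub_le_sup.
exists (sup V) => //; apply/seteqP; split=> v /=.
  by move=> Vv; rewrite in_itv /= (ub_le_sup V_ub Vv) andbT; case: Vv.
rewrite in_itv /= => /andP[v_ge0 v_le]; split=> // x Ax.
apply: le_trans (ler_wpM2r (b_ge0 x Ax) v_le) _.
(* The supremum itself satisfies the constraint at [x]: trivially if [b x = 0], and otherwise
   because [a x / b x] bounds the whole set. *)
have := b_ge0 x Ax; rewrite le_eqVlt => /predU1P[<-|bx_gt0].
  by rewrite mulr0 a_ge0.
rewrite -ler_pdivlMr //; apply: ge_sup; first by exists 0.
by move=> w [_ /(_ x Ax)]; rewrite ler_pdivlMr.
Qed.

Section Market.
Variables (R : realType) (T : nat) (I : finType) (d : 'rV[R]_T).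
Variables (X : I -> set (plan R T)) (C : I -> plan R T -> R).
Variables (N : I -> 'rV[R]_T -> plan R T -> R) (p : 'rV[R]_T).

Lemma profit0 (i : I) : profit C N i p 0 = profit_st C i p.
Proof. by apply/funext => x; rewrite /profit mul0r addr0. Qed.

Lemma profit_max0 (i : I) : profit_max X C N i p 0 = profit_st_max X C i p.
Proof. by rewrite /profit_max profit0. Qed.

Lemma lagrangianE (q : 'rV[R]_T) (v : R) (x : I -> plan R T) :
  lagrangian d C N p q v x
    = lagrangian d C N p q 0 x - v * \sum_i N i p (x i).
Proof. by rewrite /lagrangian; ring. Qed.

Lemma lagrangian_profit (v : R) (x : I -> plan R T) :
  lagrangian d C N p p v x = dotp p d - \sum_i profit C N i p v (x i).
Proof.
rewrite /lagrangian /profit /profit_st big_split sumrB /= -mulr_sumr.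
by rewrite dotpBr dotp_sumr; ring.
Qed.

(** The balance residual vanishes at a feasible point, and [q] drops out with it. *)
Lemma lagrangian_feasible (q : 'rV[R]_T) (v : R) (x : I -> plan R T) :
  feasible d X x ->
  lagrangian d C N p q v x = total_cost C x - v * \sum_i N i p (x i).
Proof.
by move=> [_ balance]; rewrite /lagrangian balance dotpBr /total_cost; ring.
Qed.

(** The individual maximizers, chosen one per producer, form a profile that minimizes the separated
    Lagrangian. *)
Lemma min_lagrangian_profit (v : R) :
  (forall i, argmax (X i) (profit C N i p v) !=set0) ->
  min_lagrangian d X C N p p v = dotp p d - \sum_i profit_max X C N i p v.
Proof.
move=> /choice[x x_max].
have -> : \sum_i profit_max X C N i p v = \sum_i profit C N i p v (x i).
  by apply: eq_bigr => i _; exact: argmax_max_on.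
rewrite -lagrangian_profit; apply: argmin_min_on; split=> [i|y Xy].
  by case: (x_max i).
rewrite !lagrangian_profit lerD2l lerN2; apply: ler_sum => i _.
exact: (x_max i).2.
Qed.

(** At a maximizer of the standard profit, the added term [v * N i p x] is nonnegative. *)
Lemma profit_st_max_le (i : I) (v : R) :
  argmax (X i) (profit_st C i p) !=set0 ->
  argmax (X i) (profit C N i p v) !=set0 ->
  (forall x, X i x -> 0 <= N i p x) -> 0 <= v ->
  profit_st_max X C i p <= profit_max X C N i p v.
Proof.
move=> [x x_max] v_att N_ge0 v_ge0; rewrite /profit_st_max (argmax_max_on x_max).
have Xx := x_max.1; apply: le_trans (le_max_on v_att Xx).
by rewrite lerDl mulr_ge0 ?N_ge0.
Qed.

Lemma min_lagrangian_le0 (q : 'rV[R]_T) (v : R) :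
  argmin (profiles X) (lagrangian d C N p q 0) !=set0 ->
  argmin (profiles X) (lagrangian d C N p q v) !=set0 ->
  (forall i x, X i x -> 0 <= N i p x) -> 0 <= v ->
  min_lagrangian d X C N p q v <= min_lagrangian d X C N p q 0.
Proof.
move=> [x x_min] v_att N_ge0 v_ge0.
rewrite {2}/min_lagrangian (argmin_min_on x_min); have Xx := x_min.1.
apply: le_trans (min_on_le v_att Xx) _.
by rewrite lagrangianE gerBl mulr_ge0 // sumr_ge0 // => i _; exact: N_ge0.
Qed.

End Market.

Theorem mainTheorem2 (R : realType) (T : nat) (I : finType)
    (d : 'rV[R]_T) (X : I -> set (plan R T)) (C : I -> plan R T -> R)
    (N : I -> 'rV[R]_T -> plan R T -> R)
    (p : 'rV[R]_T) (xstar : I -> plan R T)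
    (T_gt0 : (0 < T)%N)
    (d_ge0 : forall t, 0 <= d 0 t)
    (X_nonempty : forall i, X i !=set0)
    (X_compact : forall i, compact (X i))
    (feasible_nonempty : feasible d X !=set0)
    (xstar_optimal : argmin (feasible d X) (total_cost C) xstar)
    (profit_st_attained : forall i q, argmax (X i) (profit_st C i q) !=set0)
    (profit_attained : forall i (v : R), 0 <= v ->
       argmax (X i) (profit C N i p v) !=set0)
    (lagrangian_attained : forall q (v : R), 0 <= v ->
       argmin (profiles X) (lagrangian d C N p q v) !=set0)
    (dual_attained :
       argmax [set: 'rV[R]_T] (fun q => min_lagrangian d X C N p q 0) !=set0)
    (N_ge0 : forall i x, X i x -> 0 <= N i p x) :
  [/\ [/\ argmax (nonneg R) (min_lagrangian d X C N p p) !=set0,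
          max_on (nonneg R) (min_lagrangian d X C N p p)
            = min_lagrangian d X C N p p 0,
          argmin (nonneg R) (fun v => \sum_i profit_max X C N i p v) !=set0
        & min_on (nonneg R) (fun v => \sum_i profit_max X C N i p v)
            = \sum_i profit_st_max X C i p],
      (forall vplus, argmax (nonneg R) (min_lagrangian d X C N p p) vplus ->
         forall i, profit_max X C N i p vplus = profit_st_max X C i p) /\
      profit_preserving X C N p
        = argmax (nonneg R) (min_lagrangian d X C N p p),
      argmax [set qv : 'rV[R]_T * R | 0 <= qv.2]
             (fun qv => min_lagrangian d X C N p qv.1 qv.2) !=set0 /\
      fstar d X C
        - max_on [set qv : 'rV[R]_T * R | 0 <= qv.2]
                 (fun qv => min_lagrangian d X C N p qv.1 qv.2)
      = fstar d X C
        - max_on [set: 'rV[R]_T] (fun q => min_lagrangian d X C N p q 0)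
    & 0 < \sum_i N i p (xstar i) ->
      exists vmax : R,
        [/\ 0 <= vmax,
            argmax (nonneg R) (min_lagrangian d X C N p p) = `[0, vmax]%classic,
            argmin (profit_preserving X C N p)
                   (fun v => \sum_i (profit_max X C N i p v
                                     - profit C N i p v (xstar i))) !=set0
          & min_on (profit_preserving X C N p)
                   (fun v => \sum_i (profit_max X C N i p v
                                     - profit C N i p v (xstar i)))
            = fstar d X C - min_lagrangian d X C N p p 0
              - vmax * (\sum_i N i p (xstar i))]].
Proof.
set M := min_lagrangian d X C N p.
have M_le0 q v : 0 <= v -> M q v <= M q 0.
  by move=> v_ge0; apply: min_lagrangian_le0 => //; exact: lagrangian_attained.
have ME v : 0 <= v -> M p v = dotp p d - \sum_i profit_max X C N i p v.
  by move=> v_ge0; apply: min_lagrangian_profit => i; exact: profit_attained.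
have st_sum : \sum_i profit_max X C N i p 0 = \sum_i profit_st_max X C i p.
  by apply: eq_bigr => i _; exact: profit_max0.
have st_le v i : 0 <= v -> profit_st_max X C i p <= profit_max X C N i p v.
  move=> v_ge0; apply: profit_st_max_le => //; first exact: profit_attained.
  exact: N_ge0.
have max0 : argmax (nonneg R) (M p) 0 by split=> [|v]; [exact: lexx|exact: M_le0].
have min0 : argmin (nonneg R) (fun v => \sum_i profit_max X C N i p v) 0.
  split=> [|v v_ge0]; first exact: lexx.
  by rewrite st_sum; apply: ler_sum => i _; exact: st_le.
have preservingE : profit_preserving X C N p = argmax (nonneg R) (M p).
  apply/seteqP; split=> v [v_ge0 v_opt].
    apply/(eq_argmax max0) => //; rewrite !ME // st_sum.
    by congr (_ - _); apply: eq_bigr => i _; exact: v_opt.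
  split=> //; apply: eq_sum_le => [i|]; first exact: st_le.
  (* Equal dual values at [v] and [0] give equal sums of maximal profits once [dotp p d] is
     cancelled. *)
  have /(eq_argmax max0 v_ge0) : argmax (nonneg R) (M p) v by [].
  by rewrite !ME // st_sum => /addrI /oppr_inj.
split.
- by split; [exists 0|exact: argmax_max_on|exists 0|rewrite (argmin_min_on min0)].
- by split=> // v; rewrite -preservingE => -[].
- have [q q_max] := dual_attained.
  (* A maximizer [q] for the balance constraint alone, paired with [0], is optimal:
     [M r v <= M r 0 <= M q 0]. *)
  have q0_max : argmax [set qv : 'rV[R]_T * R | 0 <= qv.2]
      (fun qv => M qv.1 qv.2) (q, 0).
    split=> [|[r v] v_ge0] /=; first exact: lexx.
    by apply: le_trans (M_le0 r v v_ge0) _; exact: q_max.2.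
  split; first by exists (q, 0).
  by rewrite (argmax_max_on q0_max) (argmax_max_on q_max).
- move=> Nstar_gt0; have xstar_feasible := xstar_optimal.1.
  have M0_le x : profiles X x -> M p 0 <= lagrangian d C N p p 0 x.
    by move=> Xx; apply: min_on_le => //; exact: lagrangian_attained.
  (* Maximality of [v] means [M p 0 <= M p v], that is, [M p 0] is a lower bound of the Lagrangian
     at [v], which is affine in [v] for each [x]. *)
  have maxE : argmax (nonneg R) (M p) =
      [set v | 0 <= v /\ forall x, profiles X x ->
         v * \sum_i N i p (x i) <= lagrangian d C N p p 0 x - M p 0].
    apply/seteqP; split=> v [v_ge0 v_opt]; split=> //.
      move=> x Xx; rewrite lerBrDl -lerBrDr -lagrangianE.
      apply: le_trans (v_opt 0 (lexx 0)) _.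
      by apply: min_on_le => //; exact: lagrangian_attained.
    move=> w w_ge0; apply: le_trans (M_le0 p w w_ge0) _.
    (* For the converse it suffices to use the inequality at a minimizer of the Lagrangian at
       [v]. *)
    have [x x_min] := lagrangian_attained p v v_ge0.
    rewrite {2}/M /min_lagrangian (argmin_min_on x_min) lagrangianE.
    by rewrite lerBrDr -lerBrDl v_opt //; exact: x_min.1.
  have [vmax vmax_ge0 itvE] : exists2 vmax, 0 <= vmax &
      argmax (nonneg R) (M p) = `[0, vmax]%classic.
    rewrite maxE; apply: (@linear_constraints_itv _ _ _ _ _ xstar) => // [x Xx|x Xx|].
    + by rewrite subr_ge0 M0_le.
    + by apply: sumr_ge0 => i _; exact: N_ge0.
    + exact: xstar_feasible.1.
  (* For such [v] the maximal profits sum to [dotp p d - M p 0], so the objective is the Lagrangian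
     at [xstar] minus [M p 0]; feasibility of [xstar] brings in [fstar]. *)
  have objE v : profit_preserving X C N p v ->
      \sum_i (profit_max X C N i p v - profit C N i p v (xstar i))
        = fstar d X C - M p 0 - v * \sum_i N i p (xstar i).
    move=> [v_ge0 v_opt].
    have -> : fstar d X C = total_cost C xstar by exact: argmin_min_on.
    rewrite addrAC -(lagrangian_feasible C N p p v xstar_feasible).
    rewrite lagrangian_profit ME // st_sum sumrB (eq_bigr _ (fun i _ => v_opt i)).
    by ring.
  have vmax_min : argmin (profit_preserving X C N p)
      (fun v => \sum_i (profit_max X C N i p v - profit C N i p v (xstar i))) vmax.
    have Pvmax : profit_preserving X C N p vmax.
      by rewrite preservingE itvE /= in_itv /= vmax_ge0 lexx.
    (* The objective is affine in [v] with negative slope, so the comparison reduces to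
       [v <= vmax]. *)
    split=> // v Pv; rewrite !objE // lerD2l lerN2 ler_pM2r //.
    by move: Pv; rewrite preservingE itvE /= in_itv /= => /andP[].
  exists vmax; split=> //; first by exists vmax.
  by rewrite (argmin_min_on vmax_min) objE //; exact: vmax_min.1.
Qed.
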